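(* Any $CLC$-consistent formula is satisfied in some model.
   Context: Let $N$ be a finite set of agents and $\Theta$ a set of atomic propositions. CLC-formulas are given by $\phi ::= p \mid \neg\phi \mid \phi\wedge\phi \mid [H]\phi \mid K_i\phi \mid C_G\phi$ with $p\in\Theta$, $i\in N$, $H\subseteq N$, $\emptyset\neq G\subseteq N$; $E_G\phi$ abbreviates $\bigwedge_{i\in G}K_i\phi$. A model is $M=\langle S,E,\sim_1,\ldots,\sim_n,V\rangle$ with $S$ a non-empty set of states, $V$ a valuation, each $\sim_i$ an equivalence relation on $S$, and $E$ assigning to each state $s$ and coalition $G$ a set $E(G)(s)\subseteq 2^S$ that is truly playable: (E1) $\emptyset\notin E(G)(s)$; (E2) $S\in E(G)(s)$; (E3) if $S\setminus X\notin E(\emptyset)(s)$ then $X\in E(N)(s)$; (E4) if $X\subseteq Y$ and $X\in E(G)(s)$ then $Y\in E(G)(s)$; (E5) if $X\in E(G_1)(s)$, $Y\in E(G_2)(s)$ and $G_1\cap G_2=\emptyset$ then $X\cap Y\in E(G_1\cup G_2)(s)$; (E6) the set of $\subseteq$-minimal elements of $E(\emptyset)(s)$ is non-empty. Semantics: $M,s\models[G]\phi$ iff $\{t: M,t\models\phi\}\in E(G)(s)$; $M,s\models K_i\phi$ iff $\phi$ holds at every $t$ with $s\sim_i t$; $M,s\models C_G\phi$ iff $\phi$ holds at every $t$ reachable from $s$ via $(\bigcup_{i\in G}\sim_i)^*$. Consistency is with respect to the axiomatisation $CLC$: classical propositional logic; G1 $\neg[G]\bot$; G2 $[G]\top$;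 G3 $\neg[\emptyset]\neg\phi\rightarrow[N]\phi$; G4 $[G](\phi\wedge\psi)\rightarrow[G]\psi$; G5 $[G_1]\phi\wedge[G_2]\psi\rightarrow[G_1\cup G_2](\phi\wedge\psi)$ if $G_1\cap G_2=\emptyset$; MP; RG (from $\phi\leftrightarrow\psi$ infer $[G]\phi\leftrightarrow[G]\psi$); K, T, 4, 5 for each $K_i$; C1 $E_G\phi\leftrightarrow\bigwedge_{i\in G}K_i\phi$; C2 $C_G\phi\rightarrow E_G(\phi\wedge C_G\phi)$; RN (from $\phi$ infer $K_i\phi$); RC (from $\phi\rightarrow E_G(\phi\wedge\psi)$ infer $\phi\rightarrow C_G\psi$). *)

(* Defs.v *)
From HB Require Import structures.
From mathcomp Require Import all_boot.
From mathcomp Require Import boolp classical_sets.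
From Stdlib Require Import Relations.

Set Implicit Arguments.
Unset Strict Implicit.
Unset Printing Implicit Defensive.

(* Coalitions are finite sets [{set N}], sets of states are classical sets
   [set S]. Both libraries define [set0] and [setT]: the names [coal0] and
   [coalT] are those of [finset]. *)
Notation coal0 := finset.set0.
Notation coalT N := (finset.setTfor N).

Definition group (N : finType) := {G : {set N} | G != coal0}.

Inductive form (N : finType) (Theta : Type) : Type :=
| Atom (p : Theta)
| Neg (phi : form N Theta)
| And (phi psi : form N Theta)
| Can (H : {set N}) (phi : form N Theta)
| Know (i : N) (phi : form N Theta)
| Common (G : group N) (phi : form N Theta).

Arguments Atom {N Theta} p.
Arguments Neg {N Theta} phi.
Arguments And {N Theta} phi psi.
Arguments Can {N Theta} H phi.
Arguments Know {N Theta} i phi.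
Arguments Common {N Theta} G phi.

Section Syntax.
Variables (N : finType) (Theta : Type).
Implicit Types phi psi : form N Theta.

Definition Imp phi psi := Neg (And phi (Neg psi)).
Definition Iff phi psi := And (Imp phi psi) (Imp psi phi).

(* The grammar has no propositional constant: [Bot phi] is the contradiction
   built from [phi], and a schema mentioning falsum or verum ranges over all
   choices of [phi]. *)
Definition Bot phi := And phi (Neg phi).
Definition Top phi := Neg (Bot phi).

Fixpoint conj_from phi (s : seq (form N Theta)) :=
  if s is psi :: s' then And phi (conj_from psi s') else phi.

(* The conjunction of [F i] for [i] in [G]. The value on the empty coalition is
   a verum (depending on [phi]) and is not used by the axiomatisation. *)
Definition BigAnd phi (G : {set N}) (F : N -> form N Theta) :=
  if enum G is i :: s then conj_from (F i) [seq F j | j <- s] else Top phi.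

Definition Everyone (G : group N) phi := BigAnd phi (val G) (Know ^~ phi).

Fixpoint prop_eval (v : form N Theta -> bool) phi : bool :=
  match phi with
  | Neg psi => ~~ prop_eval v psi
  | And psi chi => prop_eval v psi && prop_eval v chi
  | _ => v phi
  end.

Definition tautology phi := forall v, prop_eval v phi.

Inductive provable : form N Theta -> Prop :=
| ax_prop phi : tautology phi -> provable phi
| ax_G1 G phi : provable (Neg (Can G (Bot phi)))
| ax_G2 G phi : provable (Can G (Top phi))
| ax_G3 phi :
    provable (Imp (Neg (Can coal0 (Neg phi))) (Can (coalT N) phi))
| ax_G4 G phi psi : provable (Imp (Can G (And phi psi)) (Can G psi))
| ax_G5 (G1 G2 : {set N}) phi psi : G1 :&: G2 = coal0 ->
    provable (Imp (And (Can G1 phi) (Can G2 psi))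
                  (Can (G1 :|: G2) (And phi psi)))
| ax_K i phi psi :
    provable (Imp (Know i (Imp phi psi)) (Imp (Know i phi) (Know i psi)))
| ax_T i phi : provable (Imp (Know i phi) phi)
| ax_4 i phi : provable (Imp (Know i phi) (Know i (Know i phi)))
| ax_5 i phi : provable (Imp (Neg (Know i phi)) (Know i (Neg (Know i phi))))
| ax_C1 (G : group N) phi :
    provable (Iff (Everyone G phi) (BigAnd phi (val G) (fun i => Know i phi)))
| ax_C2 G phi :
    provable (Imp (Common G phi) (Everyone G (And phi (Common G phi))))
| rule_MP phi psi : provable (Imp phi psi) -> provable phi -> provable psi
| rule_RG G phi psi :
    provable (Iff phi psi) -> provable (Iff (Can G phi) (Can G psi))
| rule_RN i phi : provable phi -> provable (Know i phi)
| rule_RC G phi psi :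
    provable (Imp phi (Everyone G (And phi psi))) ->
    provable (Imp phi (Common G psi)).

Definition consistent phi := ~ provable (Neg phi).

End Syntax.

Local Open Scope classical_set_scope.

Definition minimal_elements (S : Type) (F : set (set S)) : set (set S) :=
  [set X | F X /\ forall Y, F Y -> Y `<=` X -> Y = X].

(* [E G X]: the coalition [G] can force the outcome into [X]. *)
Record truly_playable (N : finType) (S : Type)
    (E : {set N} -> set (set S)) : Prop := TrulyPlayable {
  playable_E1 : forall G, ~ E G set0;
  playable_E2 : forall G, E G setT;
  playable_E3 : forall X, ~ E coal0 (~` X) -> E (coalT N) X;
  playable_E4 : forall G X Y, X `<=` Y -> E G X -> E G Y;
  playable_E5 : forall (G1 G2 : {set N}) X Y, E G1 X -> E G2 Y ->
    G1 :&: G2 = coal0 -> E (G1 :|: G2) (X `&` Y);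
  playable_E6 : minimal_elements (E coal0) !=set0
}.

Record model (N : finType) (Theta : Type) := Model {
  state : Type;
  state_inhabited : inhabited state;
  eff : {set N} -> state -> set (set state);
  acc : N -> relation state;
  val_of : Theta -> set state;
  eff_playable : forall s, truly_playable (eff ^~ s);
  acc_equivalence : forall i, equivalence state (acc i)
}.

Arguments eff {N Theta} m G s.
Arguments acc {N Theta} m i.
Arguments val_of {N Theta} m p.

Definition group_reach (N : finType) (Theta : Type) (M : model N Theta)
    (G : {set N}) : relation (state M) :=
  clos_refl_trans (state M) (fun s t => exists2 i, i \in G & acc M i s t).

Fixpoint sat (N : finType) (Theta : Type) (M : model N Theta) (s : state M)
    (phi : form N Theta) {struct phi} : Prop :=
  match phi with
  | Atom p => val_of M p s
  | Neg psi => ~ sat s psi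
  | And psi chi => sat s psi /\ sat s chi
  | Can G psi => eff M G s [set t | sat t psi]
  | Know i psi => forall t, acc M i s t -> sat t psi
  | Common G psi => forall t, group_reach (val G) s t -> sat t psi
  end.

(* Main.v *)
(** The canonical model is filtrated through a finite set [cl] of formulas: a
    state is the trace on [cl] of a maximal consistent set, and we fix a
    maximal consistent representative of each state. Since there are finitely
    many states, every set [X] of states is defined by a formula, and a
    coalition [G] is declared effective for [X] when the representative
    contains [[G]] applied to this formula; the axioms G1-G5 then give E1-E5
    directly, and finiteness gives E6. Two states are [i]-related when they
    contain the same formulas [K_i a] of [cl]. For common knowledge, the
    formula [r] defining the set reachable from a state where [C_G a] is
    semantically true satisfies [r -> E_G (r /\ a)], so that rule RC yields
    [r -> C_G a]; conversely [cl] contains [K_i C_G a] along with [C_G a], which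
    propagates [C_G a] along paths. *)
Require Import Defs.
From HB Require Import structures.
From mathcomp Require Import all_boot.
From mathcomp Require Import boolp classical_sets.
From Stdlib Require Import Relations.

Set Implicit Arguments.
Unset Strict Implicit.
Unset Printing Implicit Defensive.

Local Open Scope classical_set_scope.

(** [Theta] is an arbitrary type, so equality of formulas is decided classically. *)
HB.instance Definition _ (N : finType) (Theta : Type) :=
  gen_eqMixin (form N Theta).

Ltac prove_tautology :=
  apply: ax_prop => ? /=;
  repeat match goal with |- context [prop_eval ?v ?a] =>
    case: (prop_eval v a) => //= end.

(** * Theories and maximal consistent sets *)

Section Canonical.
Variables (N : finType) (Theta : Type).
Local Notation fm := (form N Theta).
Implicit Types (a b c : fm) (T : set fm).

(** Rules RG, RN and RC preserve validity but not truth at a state, so closure under them is not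
    asked. *)
Record theory T : Prop := Theory {
  theory_provable : forall a, provable a -> T a;
  theory_MP : forall a b, T (Imp a b) -> T a -> T b }.

Record mcs := Mcs {
  members :> fm -> Prop;
  mcs_theory : theory members;
  mcs_contra : forall a, members a -> ~ members (Neg a);
  mcs_complete : forall a, members a \/ members (Neg a) }.
Implicit Types g d : mcs.

Lemma theory_extend T a :
  theory T -> theory [set b | T (Imp a b)].
Proof.
move=> thT; split=> [b pb|b c /= abc ab].
  apply: (theory_MP thT) (theory_provable thT pb).
  by apply: (theory_provable thT); prove_tautology.
apply: (theory_MP thT) ab; apply: (theory_MP thT) abc.
by apply: (theory_provable thT); prove_tautology.
Qed.

Lemma lindenbaum T a :
  theory T -> ~ T a -> exists2 g : mcs, T `<=` members g & ~ g a.
Proof.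
move=> thT nTa.
(* The union with [T] makes the empty chain harmless. *)
pose P A := theory (T `|` A) /\ ~ (T `|` A) a.
have [|A [[thA nAa] Amax]] := @Zorn_bigcup fm P.
  move=> F FP Ftot; split; last first.
    by case=> // -[X FX Xa]; have [_] := FP _ FX; apply; right.
  split=> [b /(theory_provable thT)|b c]; first by left.
  have via X : F X -> (T `|` X) (Imp b c) -> (T `|` X) b ->
      (T `|` \bigcup_(Y in F) Y) c.
    move=> FX bc xb; have [thX _] := FP _ FX.
    by case: (theory_MP thX bc xb); [left | right; exists X].
  case=> [Tbc|[X FX Xbc]] [Tb|[Y FY Yb]].
  - by left; apply: (theory_MP thT) Tbc Tb.
  - by apply: (via Y) => //; [left | right].
  - by apply: (via X) => //; [right | left].
  - have [XY|YX] := Ftot _ _ FX FY.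
      by apply: (via Y) => //; right => //; apply: XY.
    by apply: (via X) => //; right => //; apply: YX.
set U := T `|` A in thA nAa.
(* [[set c | U (Imp b c)]] is the theory generated by [U] and [b]. It properly extends [A], so by
   maximality it contains [a]. *)
have outside b : ~ U b -> U (Imp b a).
  move=> nUb; apply: contrapT => nUba.
  have TB : T `|` [set c | U (Imp b c)] = [set c | U (Imp b c)].
    apply/seteqP; split=> c; last by right.
    case=> // Tc; apply: (theory_MP thA (a := c)); last by left.
    by apply: (theory_provable thA); prove_tautology.
  refine (Amax [set c | U (Imp b c)] _ _).
    split=> [c Ac|sub]; last first.
      apply: nUb; right; apply: sub.
      by apply: (theory_provable thA); prove_tautology.
    apply: (theory_MP thA (a := c)); last by right.
    by apply: (theory_provable thA); prove_tautology.
  by split; rewrite TB //; apply: theory_extend.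
have Ucontra b : U b -> ~ U (Neg b).
  move=> Ub Unb; apply: nAa.
  apply: (theory_MP thA) Unb; apply: (theory_MP thA) Ub.
  by apply: (theory_provable thA); prove_tautology.
have Ucomplete b : U b \/ U (Neg b).
  apply: contrapT => /not_orP[/outside ba /outside nba].
  apply: nAa; apply: (theory_MP thA) nba; apply: (theory_MP thA) ba.
  by apply: (theory_provable thA); prove_tautology.
by exists (Mcs thA Ucontra Ucomplete) => // b Tb; left.
Qed.

Lemma theory_of_provable : theory (@provable N Theta).
Proof. by split=> // a b; apply: rule_MP. Qed.

(** With [mcs_provable], this replaces Hilbert-style derivations by reasoning about membership in
    all maximal consistent sets. *)
Lemma provable_mcs a : (forall g, g a) -> provable a.
Proof.
move=> ga; apply: contrapT => /(lindenbaum theory_of_provable)[g _].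
by apply.
Qed.

Lemma mcs_provable g a : provable a -> g a.
Proof. exact: theory_provable (mcs_theory g) a. Qed.

Lemma mcs_MP g a b : g (Imp a b) -> g a -> g b.
Proof. exact: theory_MP (mcs_theory g) a b. Qed.

Lemma mcs_Neg g a : g (Neg a) <-> ~ g a.
Proof.
split=> [gna ga|nga]; first exact: mcs_contra ga gna.
by case: (mcs_complete g a).
Qed.

Lemma mcs_And g a b : g (And a b) <-> g a /\ g b.
Proof.
split=> [gab|[ga gb]].
  by split; apply: mcs_MP gab; apply: mcs_provable; prove_tautology.
by apply: mcs_MP gb; apply: mcs_MP ga; apply: mcs_provable; prove_tautology.
Qed.

Lemma mcs_Imp g a b : g (Imp a b) <-> (g a -> g b).
Proof.
split; first exact: mcs_MP.
move=> gab; apply/mcs_Neg => /mcs_And[ga /mcs_Neg]; apply; exact: gab.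
Qed.

Lemma mcs_Top g a : g (Top a).
Proof. by apply: mcs_provable; prove_tautology. Qed.

Lemma mcs_Iff g a b : g (Iff a b) <-> (g a <-> g b).
Proof.
split=> [/mcs_And[/mcs_Imp ? /mcs_Imp ?]|[? ?]]; first by split.
by apply/mcs_And; split; apply/mcs_Imp.
Qed.

Lemma mcs_conj_from g a (s : seq fm) :
  g (conj_from a s) <-> forall b, b \in a :: s -> g b.
Proof.
elim: s a => [|b s IHs] a /=.
  by split=> [ga c|]; [rewrite inE => /eqP-> | apply; rewrite mem_head].
split=> [/mcs_And[ga /IHs gs] c|gs].
  by rewrite inE => /predU1P[->|/gs].
apply/mcs_And; split; first by apply: gs; rewrite mem_head.
by apply/IHs => c cs; apply: gs; rewrite inE cs orbT.
Qed.

Lemma mcs_BigAnd g a (G : {set N}) (F : N -> fm) :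
  g (BigAnd a G F) <-> forall i, i \in G -> g (F i).
Proof.
rewrite /BigAnd; have := mem_enum G; case: (enum G) => [|i s] Gs.
  by split=> [_ i|_]; [rewrite -Gs | apply: mcs_Top].
split=> [/mcs_conj_from gs j|gs].
  by rewrite -Gs => js; apply: gs; apply: (map_f F js).
apply/mcs_conj_from => b /(@mapP _ _ F (i :: s))[j js ->].
by apply: gs; rewrite -Gs.
Qed.

Lemma mcs_Everyone g (G : group N) a :
  g (Everyone G a) <-> forall i, i \in val G -> g (Know i a).
Proof. exact: mcs_BigAnd. Qed.

(** * Modal axioms in maximal consistent sets *)

Lemma mcs_Can_equiv g (G : {set N}) a b :
  (forall d, d a <-> d b) -> g (Can G a) <-> g (Can G b).
Proof.
move=> ab; apply/mcs_Iff/mcs_provable/rule_RG/provable_mcs => d.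
exact/mcs_Iff.
Qed.

(** Since [a] entails [b], it is equivalent to [And a b]; RG then produces the premise of G4. *)
Lemma mcs_Can_mono g (G : {set N}) a b :
  (forall d, d a -> d b) -> g (Can G a) -> g (Can G b).
Proof.
move=> ab ga; apply: mcs_MP (mcs_provable _ (ax_G4 G a b)) _.
have aab d : d (And a b) <-> d a.
  by split=> [/mcs_And[]//|da]; apply/mcs_And; split=> //; apply: ab.
exact/(mcs_Can_equiv g G aab).
Qed.

Lemma mcs_Know_T g i a : g (Know i a) -> g a.
Proof. exact: mcs_MP (mcs_provable _ (ax_T i a)). Qed.

Lemma theory_Know g i : theory [set a | g (Know i a)].
Proof.
split=> [a pa|a b /= gab]; first by apply/mcs_provable/rule_RN.
by apply: mcs_MP; apply: mcs_MP gab; apply/mcs_provable/ax_K.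
Qed.

Lemma mcs_Common_step g (G : group N) a i : g (Common G a) -> i \in val G ->
  g (Know i (Common G a)) /\ g a.
Proof.
move=> /(mcs_MP (mcs_provable _ (ax_C2 G a)))/mcs_Everyone gE Gi.
have {gE} := gE _ Gi => gK; split; last by case/mcs_Know_T/mcs_And: gK.
apply: theory_MP (theory_Know g i) _ _ _ gK.
(* Generalising [Common G a] keeps its value in the form [prop_eval v b], on which the tautology
   tactic splits. *)
by move: (Common G a) => b /=; apply/mcs_provable/rule_RN; prove_tautology.
Qed.

(** * Filtration through a finite set of formulas *)

Section Filtration.
Variables (base : fm) (cl : seq fm).

Definition profile g : (size cl).-tuple bool :=
  map_tuple (fun a => `[< g a >]) (in_tuple cl).

Definition fstate : Type :=
  {p : (size cl).-tuple bool | `[< exists g, profile g = p >]}.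
HB.instance Definition _ := Finite.on fstate.
Implicit Types (s t : fstate) (X Y : set fstate).

Lemma class_subproof g : `[< exists d, profile d = profile g >].
Proof. by apply/asboolP; exists g. Qed.

Definition class g : fstate := exist _ (profile g) (class_subproof g).

Definition rep s : mcs := projT1 (cid (asboolW (valP s))).

Lemma repK s : class (rep s) = s.
Proof. by apply: val_inj; rewrite /= /rep; case: cid. Qed.

Lemma class_eq g d :
  class g = class d <-> forall a, a \in cl -> g a <-> d a.
Proof.
split=> [/(congr1 (val \o val)) /= /eq_in_map gd a /gd|gd].
  exact: asbool_eq_equiv.
apply/val_inj/val_inj/eq_in_map => a /gd; exact: asbool_equiv_eq.
Qed.

Lemma rep_class g a : a \in cl -> rep (class g) a <-> g a.
Proof. by have /class_eq := repK (class g); apply. Qed.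

Definition literal s a := if `[< rep s a >] then a else Neg a.
(** The head [Top base] gives the conjunction a value when [cl] is empty. *)
Definition char_state s := conj_from (Top base) [seq literal s a | a <- cl].

Lemma mcs_char_state g s : g (char_state s) <-> class g = s.
Proof.
rewrite -[X in _ = X]repK class_eq; split=> [/mcs_conj_from gs a acl|gs].
  have := gs (literal s a); rewrite inE map_f ?orbT // => /(_ isT).
  rewrite /literal; case: asboolP => // nsa /mcs_Neg; tauto.
apply/mcs_conj_from => b; rewrite inE => /predU1P[->|]; first exact: mcs_Top.
case/mapP=> a /gs gsa ->; rewrite /literal; case: asboolP => [/gsa //|nsa].
by apply/mcs_Neg => /gsa.
Qed.

(** De Morgan form of the disjunction of the [char_state s] for [s] in [X]; for empty [X] it is the
    falsum [Neg (Top base)]. *)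
Definition char_set X :=
  Neg (conj_from (Top base)
    [seq Neg (char_state s) | s <- enum {: fstate} & `[< X s >]]).

Lemma mcs_char_set g X : g (char_set X) <-> X (class g).
Proof.
rewrite mcs_Neg mcs_conj_from; split=> [nX|Xg].
  apply: contrapT => nXg; apply: nX => b; rewrite inE.
  case/predU1P=> [->|/mapP[s]]; first exact: mcs_Top.
  rewrite mem_filter => /andP[/asboolP Xs _] ->.
  by apply/mcs_Neg => /mcs_char_state gs; apply: nXg; rewrite gs.
move=> /(_ (Neg (char_state (class g)))).
rewrite inE map_f ?orbT; last first.
  by rewrite mem_filter mem_enum andbT; apply/asboolP.
by move=> /(_ isT)/mcs_Neg; apply; apply/mcs_char_state.
Qed.

(* The coalition formulas [Can G (char_set X)] need not lie in [cl], so [feff]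
   depends on the representative chosen for [s]; a maximal consistent one is
   needed for (E3). *)
Definition feff (G : {set N}) s : set (set fstate) :=
  [set X | rep s (Can G (char_set X))].

Lemma feff_playable s : truly_playable (feff ^~ s).
Proof.
have mono G X Y : X `<=` Y -> feff G s X -> feff G s Y.
  by move=> XY; apply: mcs_Can_mono => d /mcs_char_set/XY/mcs_char_set.
have full G : feff G s setT.
  apply: mcs_Can_mono (mcs_provable _ (ax_G2 G base)) => d _.
  exact/mcs_char_set.
split=> //.
- move=> G sG; have /mcs_Neg := mcs_provable (rep s) (ax_G1 G base); apply.
  by apply: mcs_Can_mono sG => d /mcs_char_set.
- move=> X nX; apply: mcs_MP (mcs_provable _ (ax_G3 _)) _.
  apply/mcs_Neg => sX; apply: nX; apply: mcs_Can_mono sX => d /mcs_Neg dX.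
  by apply/mcs_char_set => Xd; apply: dX; apply/mcs_char_set.
- move=> G1 G2 X Y sX sY dis.
  apply: mcs_Can_mono (mcs_MP (mcs_provable _ (ax_G5 _ _ dis)) _).
    move=> d /mcs_And[dX dY]; apply/mcs_char_set.
    by split; apply/mcs_char_set; [exact: dX | exact: dY].
  by apply/mcs_And.
(* For E6, a minimal set is sought among the finite sets of states, starting from the full one; [B]
   below transfers its minimality to classical sets. *)
have [|A /minsetP[/asboolP sA Amin] _] :=
    @minset_exists _ (fun A : {set fstate} => `[< feff coal0 s [set` A] >])
      (coalT _).
  by apply/asboolP; apply: mono (full _) => t _ /=; rewrite inE.
exists [set` A]; split=> // Y sY YA.
pose B := [set t | `[< Y t >]]%SET.
have BY : [set` B] = Y.
  by apply/seteqP; split=> t /=; rewrite inE => /asboolP.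
rewrite -BY (Amin B) //; first by rewrite BY; apply/asboolP.
by apply/fintype.subsetP => t; rewrite inE => /asboolP/YA.
Qed.

Definition facc i s t :=
  forall a, Know i a \in cl -> rep s (Know i a) <-> rep t (Know i a).

Lemma facc_equivalence i : equivalence fstate (facc i).
Proof.
split=> [s a //|s t u st tu a acl|s t st a /st]; last by tauto.
by rewrite (st _ acl); apply: tu.
Qed.

Lemma facc_class i g d : facc i (class g) (class d) <->
  forall a, Know i a \in cl -> g (Know i a) <-> d (Know i a).
Proof.
by split=> gd a acl; have := gd a acl;
  have := rep_class g acl; have := rep_class d acl; tauto.
Qed.

(** If [g] lacks [Know i a], some [d] contains all that [i] knows in [g] but omits [a]. By axioms 4
    and 5, [g] and [d] agree on every [Know i b], so their classes are related. *)
Lemma mcs_Know_facc g i a :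
  (forall d, facc i (class g) (class d) -> d a) -> g (Know i a).
Proof.
move=> ga; apply: contrapT => /(lindenbaum (theory_Know g i))[d gd]; apply.
apply/ga/facc_class => b bcl; split=> [gb|db].
  by apply/gd; apply: mcs_MP gb; apply/mcs_provable/ax_4.
apply: contrapT => /mcs_Neg gnb.
suff /mcs_Neg : d (Neg (Know i b)) by apply.
by apply/gd; apply: mcs_MP gnb; apply/mcs_provable/ax_5.
Qed.

Definition fmodel s0 : model N Theta :=
  Model (inhabits s0) (fun p => [set s | rep s (Atom p)])
    feff_playable facc_equivalence.

End Filtration.

(** * Closure of a formula and the truth lemma *)

Fixpoint closure a : seq fm :=
  a :: match a with
  | Atom _ => [::]
  | Neg b | Can _ b | Know _ b => closure b
  | And b c => closure b ++ closure c
  | Common G b => [seq Know i a | i : N] ++ closure b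
  end.

Lemma closure_self a : a \in closure a.
Proof. by case: a => *; rewrite mem_head. Qed.

Section Truth.
Variables (base : fm) (cl : seq fm) (s0 : fstate cl).
Local Notation M := (fmodel base s0).
Implicit Types s t : fstate cl.

Lemma truth_Common (G : group N) a s :
    (forall t, sat (M := M) t a <-> rep t a) ->
    {subset closure (Common G a) <= cl} ->
  sat (M := M) s (Common G a) <-> rep s (Common G a).
Proof.
move=> IHa sub; split=> [sC|].
  (* The formula of [R] is a post-fixed point to which rule RC applies. *)
  pose R := [set t | group_reach (M := M) (val G) s t].
  suff : rep s (Imp (char_set base R) (Common G a)).
    move/mcs_Imp; apply; apply/mcs_char_set; rewrite repK.
    exact: rt_refl.
  apply/mcs_provable/rule_RC/provable_mcs => g.
  apply/mcs_Imp => /mcs_char_set Rg; apply/mcs_Everyone => i Gi.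
  apply: (@mcs_Know_facc cl) => d gd.
  have Rd : R (class cl d).
    by apply: rt_trans Rg _; apply: rt_step; exists i.
  apply/mcs_And; split; first exact/mcs_char_set.
  have acl : a \in cl.
    by apply: sub; rewrite /= inE mem_cat closure_self !orbT.
  by apply/(rep_class _ acl)/IHa; apply: sC.
(* At the end of a path, some agent of [G] is needed to extract [a] from [Common G a] by C2 and
   T. *)
have [i0 Gi0] : exists i, i \in val G by apply/finset.set0Pn; case: (G).
move=> sC t st; have {st} := clos_rt_rt1n _ _ _ _ st.
move=> st; elim: st sC => {s t} [s sC|s t u [i Gi st] _ IHt sC].
  by apply/IHa; case: (mcs_Common_step sC Gi0).
apply: IHt; have [sK _] := mcs_Common_step sC Gi.
have Kcl : Know i (Common G a) \in cl.
  apply: sub; rewrite /= inE mem_cat.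
  by rewrite (map_f (Know ^~ (Common G a))) ?orbT ?mem_enum.
exact/(@mcs_Know_T _ i)/(st _ Kcl).
Qed.

Lemma truth a s :
  {subset closure a <= cl} -> sat (M := M) s a <-> rep s a.
Proof.
elim: a s => [p|b IHb|b IHb c IHc|H b IHb|i b IHb|G b IHb] s sub //=.
- rewrite mcs_Neg IHb // => c bc; apply: sub.
  by rewrite /= inE bc orbT.
- rewrite mcs_And IHb ?IHc // => d dc; apply: sub;
    by rewrite /= inE mem_cat dc !orbT.
- have IH t : sat (M := M) t b <-> rep t b.
    by apply: IHb => c bc; apply: sub; rewrite /= inE bc orbT.
  (* As [b] is in [cl], it is equivalent to the characteristic formula of its truth set, and RG
     exchanges the two under [Can H]. *)
  apply: mcs_Can_equiv => d; rewrite mcs_char_set /= IH rep_class //.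
  by apply: sub; rewrite /= inE closure_self orbT.
- have IH t : sat (M := M) t b <-> rep t b.
    by apply: IHb => c bc; apply: sub; rewrite /= inE bc orbT.
  have bcl : b \in cl by apply: sub; rewrite /= inE closure_self orbT.
  split=> [sK|sK t st].
    apply: (@mcs_Know_facc cl) => d; rewrite repK => sd.
    by apply/(rep_class _ bcl)/IH/sK.
  have Kcl : Know i b \in cl by apply: sub; exact: mem_head.
  exact/IH/(@mcs_Know_T _ i)/(st _ Kcl).
- apply: truth_Common => // t; apply: IHb => c bc; apply: sub.
  by rewrite /= inE mem_cat bc !orbT.
Qed.

End Truth.
End Canonical.

Theorem theorem1 (N : finType) (Theta : Type) (phi : form N Theta) :
  consistent phi -> exists (M : model N Theta) (s : state M), sat s phi.
Proof.
move=> /(lindenbaum (theory_of_provable _ _))[g _ gN].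
have gphi : g phi by apply: contrapT => /mcs_Neg.
pose s0 := class (closure phi) g.
exists (fmodel phi s0), s0; apply/truth => //.
by apply/rep_class => //; exact: closure_self.
Qed.
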